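(* For the polynomial $M_d(t)=\binom{t+d}{d}+\binom{t}{d}$, which is not an Ehrhart polynomial, if $\beta_d$ is the root of $M_d(t)$ of maximal norm, then \[\left|\beta_d+\tfrac12\right|=\frac{d^2}{\pi}+O(1)\] as $d\to\infty$.
   Context: Here $d$ is a positive integer, and for an integer $k$, $\binom{t+k}{d}$ denotes the polynomial $\frac{(t+k)(t+k-1)\cdots(t+k-d+1)}{d!}$ in $t$. A lattice polytope is a convex polytope $P\subset\mathbb{R}^n$ (for some $n$) all of whose vertices lie in $\mathbb{Z}^n$; its dimension is the dimension of its affine span. If $P$ is a lattice polytope of dimension $d$, the number of points of $\mathbb{Z}^n$ in the dilate $tP$, for non-negative integers $t$, is given by a polynomial $L_P(t)$ in $t$ of degree $d$, called the Ehrhart polynomial of $P$. A polynomial is called an Ehrhart polynomial if it equals $L_P(t)$ for some lattice polytope $P$. Roots are taken in $\mathbb{C}$, and the norm of a root means its complex absolute value.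
   Formalization: The claim that M_d is not an Ehrhart polynomial is stated only for d ≥ 2, since for d = 1 it fails: M_1(t) = 2t+1 is the Ehrhart polynomial of the segment [0,2]. *)

(* Defs.v *)
From HB Require Import structures.
From mathcomp Require Import all_boot all_order all_algebra.
From mathcomp Require Import complex.
From mathcomp Require Import all_classical all_reals all_analysis.

Set Implicit Arguments.
Unset Strict Implicit.
Unset Printing Implicit Defensive.

Import Order.TTheory GRing.Theory Num.Theory.
Import numFieldNormedType.Exports.

Local Open Scope classical_set_scope.
Local Open Scope card_scope.
Local Open Scope ring_scope.

Section Ehrhart.
Variable R : realType.

Definition convex_hull n (A : set 'rV[R]_n) : set 'rV[R]_n :=
  smallest (@convex_set R 'rV[R]_n) A.

Definition convex_polytope n (P : set 'rV[R]_n) : Prop :=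
  exists2 A : set 'rV[R]_n, finite_set A /\ A !=set0 & P = convex_hull A.

(* The vertices of a polytope are its extreme points. *)
Definition vertex n (P : set 'rV[R]_n) (x : 'rV[R]_n) : Prop :=
  P x /\ forall y z (s : R), P y -> P z -> 0 < s < 1 ->
    x = s *: y + (1 - s) *: z -> y = x /\ z = x.

Definition lattice_point n (x : 'rV[R]_n) : Prop :=
  forall i, x ord0 i \is a Num.int.

Definition lattice_polytope n (P : set 'rV[R]_n) : Prop :=
  convex_polytope P /\ vertex P `<=` @lattice_point n.

Definition dilate n (t : nat) (P : set 'rV[R]_n) : set 'rV[R]_n :=
  [set t%:R *: x | x in P].

(* A polynomial is determined by its values on the natural numbers, so these
   conditions say that p is the polynomial L_P. *)
Definition ehrhart_polynomial_of n (P : set 'rV[R]_n) (p : {poly R}) : Prop :=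
  forall t : nat, exists2 k : nat,
    dilate t P `&` @lattice_point n #= `I_k & p.[t%:R] = k%:R.

Definition is_ehrhart_polynomial (p : {poly R}) : Prop :=
  exists n (P : set 'rV[R]_n), lattice_polytope P /\ ehrhart_polynomial_of P p.

(* (t+k)(t+k-1)...(t+k-d+1) / d! as a polynomial in t = 'X. *)
Definition binomial_poly (k : int) (d : nat) : {poly R} :=
  (d`!%:R)^-1 *: \prod_(i < d) ('X + (k%:~R - i%:R)%:P).

(* M_poly 1 = 2t + 1 is the Ehrhart polynomial of a segment of lattice length 2,
   so among positive d only d >= 2 can fail to give an Ehrhart polynomial. *)
Definition M_poly (d : nat) : {poly R} :=
  binomial_poly d d + binomial_poly 0 d.

Definition complex_root (p : {poly R}) (z : R[i]) : Prop :=
  root (map_poly (real_complex R) p) z.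

(* The root of maximal norm need not be unique (nonreal roots come in conjugate
   pairs), so this is a predicate. The order on R[i] compares real values, in
   particular norms, as in R. *)
Definition max_norm_root (p : {poly R}) (z : R[i]) : Prop :=
  complex_root p z /\ forall w, complex_root p w -> `|w| <= `|z|.

End Ehrhart.

(* Main.v *)
(* A lattice polytope P with Ehrhart polynomial M_d, d >= 2, would have
   M_d(1) = d + 1 lattice points, which span P because its vertices are among them.  The
   growth of M_d forces them to be affinely independent, so P is a simplex with vertices
   w_0, ..., w_d, and tP contains binom(t+d, d) points with natural barycentric
   coordinates.  As M_d(t) = binom(t+d, d) for t < d, these are all the lattice points of
   tP, whereas dP contains one more.  The fractional parts f_i of its coordinates are again
   coordinates of a lattice point; their sum s satisfies 0 < s < d + 1, and s < d is
   excluded, so s = d.  Then the 1 - f_i are nonintegral coordinates, with sum 1, of a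
   lattice point of P: a contradiction.

   With x = z + 1/2 and c_i = i + 1/2 the equation M_d(z) = 0 reads
   prod (x + c_i) + prod (x - c_i) = 0.  Comparing moduli gives Re x = 0, and for x = iy
   with y <> 0 the equation becomes cos S(1/y) = 0, where S(w) = sum_i atan (c_i w).
   Since sum_i c_i = d^2/2, the bound atan t <= t gives |y| <= d^2/pi, and
   t - t^3 <= atan t with the intermediate value theorem gives a root with
   y >= d^2/pi - 16. *)
Require Import Defs.
From HB Require Import structures.
From mathcomp Require Import all_boot all_order all_algebra.
From mathcomp Require Import complex.
From mathcomp Require Import all_classical all_reals all_analysis.
From mathcomp Require Import ring lra zify.

Set Implicit Arguments.
Unset Strict Implicit.
Unset Printing Implicit Defensive.

Import Order.TTheory GRing.Theory Num.Theory.
Import numFieldNormedType.Exports.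

Local Open Scope classical_set_scope.
Local Open Scope ring_scope.

(** * Roots *)

(** The morphism [f] is arbitrary so as to cover both complex roots ([real_complex]) and values at
    naturals ([idfun]). *)
Lemma horner_binomial_poly {R : realType} (S : comNzRingType) (f : {rmorphism R -> S})
    (k d : nat) (z : S) :
  (map_poly f (binomial_poly R k%:Z d)).[z] =
  f (d`!%:R)^-1 * \prod_(i < d) (z + k%:R - i%:R).
Proof.
rewrite /binomial_poly linearZ /= hornerZ rmorph_prod horner_prod.
congr (_ * _); apply: eq_bigr => i _.
by rewrite rmorphD /= map_polyX map_polyC /= !hornerE rmorphB /= -pmulrn !rmorph_nat addrA.
Qed.

Lemma M_poly_rootE {R : realType} (d : nat) (z : R[i]) :
  complex_root (M_poly R d) z <->
  \prod_(i < d) (z + 2^-1 + (i%:R + 2^-1)) +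
  \prod_(i < d) (z + 2^-1 - (i%:R + 2^-1)) = 0.
Proof.
rewrite /complex_root /root /M_poly rmorphD hornerD /=.
rewrite !horner_binomial_poly -mulrDr mulf_eq0.
have /negPf -> : real_complex R (d`!%:R)^-1 != 0.
  by rewrite fmorph_eq0 invr_eq0 pnatr_eq0 -lt0n fact_gt0.
have half : 2^-1 + 2^-1 = 1 :> R[i].
  by rewrite -mulr2n -[_ *+ 2]mulr_natr mulVf // pnatr_eq0.
(* Reversing the first product pairs its factors with those of the second:
   [z + d - (d - 1 - i) = x + c_i] against [z - i = x - c_i]. *)
rewrite /= (reindex_inj rev_ord_inj) /=.
under eq_bigr => i _.
  have -> : z + d%:R - (d - i.+1)%:R = z + 2^-1 + (i%:R + 2^-1).
    have e : i.+1%:R = i%:R + (2^-1 + 2^-1) :> R[i] by rewrite half natr1.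
    rewrite natrB ?ltn_ord // e; ring.
  over.
under [X in _ + X == _]eq_bigr => i _.
  have -> : z + 0%:R - i%:R = z + 2^-1 - (i%:R + 2^-1) by ring.
  over.
by split=> /eqP.
Qed.

Lemma normc_ltE {R : realType} (x y : R[i]) :
  complex.Re x ^+ 2 + complex.Im x ^+ 2 < complex.Re y ^+ 2 + complex.Im y ^+ 2 ->
  `|x| < `|y|.
Proof.
move=> h; rewrite !normc_def ltcR ltr_sqrt //.
by apply: le_lt_trans h; rewrite addr_ge0 ?sqr_ge0.
Qed.

(* Each factor [x + c i] strictly dominates [x - c i] in modulus when [Re x > 0],
   and conversely when [Re x < 0]. *)
Lemma Re_prod_sym_eq0 {R : realType} (d : nat) (c : nat -> R) (x : R[i]) :
  (0 < d)%N -> (forall i, 0 < c i) ->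
  \prod_(i < d) (x + (c i)%:C%C) + \prod_(i < d) (x - (c i)%:C%C) = 0 ->
  complex.Re x = 0.
Proof.
move=> d0 c0 /eqP; rewrite addr_eq0 => /eqP /(congr1 Num.norm).
rewrite normrN !normr_prod.
case: x => a b /= h; apply/eqP; case: ltgtP => // a0; exfalso; move: h => /eqP.
- rewrite lt_eqF // ltr_prod //=.
    by apply/hasP; exists (Ordinal d0); rewrite ?mem_index_enum.
  move=> i _; rewrite normr_ge0 /=; apply: normc_ltE; simpc => /=.
  by have := c0 i; nra.
- rewrite gt_eqF // ltr_prod //=.
    by apply/hasP; exists (Ordinal d0); rewrite ?mem_index_enum.
  move=> i _; rewrite normr_ge0 /=; apply: normc_ltE; simpc => /=.
  by have := c0 i; nra.
Qed.

Lemma polar_atan {R : realType} (x : R) :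
  (1 +i* x = (Num.sqrt (1 + x ^+ 2))%:C * (cos (atan x) +i* sin (atan x)))%C.
Proof.
have s0 : Num.sqrt (1 + x ^+ 2) != 0.
  by rewrite sqrtr_eq0 -ltNge; have := sqr_ge0 x; lra.
have -> : sin (atan x) = x * cos (atan x).
  rewrite -{2}[x]atanK /tan divfK // cos_atan invr_eq0; exact: s0.
rewrite cos_atan; simpc; apply/eqP; rewrite eq_complex /= divff // eqxx /=.
by rewrite mulrCA divff // mulr1.
Qed.

(** Arguments add under multiplication; of the modulus only its positivity is needed. *)
Lemma prod_polar_atan {R : realType} (c : nat -> R) (d : nat) :
  exists2 r : R, 0 < r &
  (\prod_(i < d) (1 +i* c i) =
    r%:C * (cos (\sum_(i < d) atan (c i)) +i* sin (\sum_(i < d) atan (c i))))%C.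
Proof.
elim: d => [|d [r r0 IH]].
  by exists 1; rewrite // !big_ord0 cos0 sin0 mul1r.
exists (r * Num.sqrt (1 + c d ^+ 2)).
  by rewrite mulr_gt0 // sqrtr_gt0; have := sqr_ge0 (c d); lra.
rewrite !big_ord_recr /= IH polar_atan cosD sinD rmorphM /=.
rewrite mulrACA; congr (_ * _); simpc; congr (_ +i* _)%C; ring.
Qed.

(** Pulling [iy] out of each factor, [iy - c = iy (1 + i c/y)] and [iy + c = iy (1 - i c/y)], leaves
    a product [Q] and its conjugate. The sum is [(iy)^d * 2 Re Q], and [Re Q] is a positive multiple
    of the cosine. *)
Lemma imaginary_rootE {R : realType} (d : nat) (c : nat -> R) (y : R) :
  y != 0 ->
  (\prod_(i < d) ((0 +i* y)%C + (c i)%:C%C) +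
   \prod_(i < d) ((0 +i* y)%C - (c i)%:C%C) = 0) <->
  cos (\sum_(i < d) atan (c i * y^-1)) = 0.
Proof.
move=> y0.
have [r r0 hp] := prod_polar_atan (fun i => c i * y^-1) d.
set S := \sum_(i < d) _ in hp *.
have y0' : (0 +i* y)%C != 0 by rewrite eq_complex /= eqxx.
have -> : \prod_(i < d) ((0 +i* y)%C - (c i)%:C%C) =
    (0 +i* y)%C ^+ d * \prod_(i < d) (1 +i* (c i * y^-1))%C.
  rewrite -[d in _ ^+ d]card_ord -prodr_const -big_split /=; apply: eq_bigr => i _.
  by simpc; rewrite mulrCA divff // mulr1.
have -> : \prod_(i < d) ((0 +i* y)%C + (c i)%:C%C) =
    (0 +i* y)%C ^+ d * (\prod_(i < d) (1 +i* (c i * y^-1))%C)^*%C.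
  rewrite rmorph_prod -[d in _ ^+ d]card_ord -prodr_const -big_split /=.
  by apply: eq_bigr => i _; simpc; rewrite mulrCA divff // mulr1.
rewrite -mulrDr [_^*%C + _]addrC addcJ hp.
have -> : complex.Re (r%:C * (cos S +i* sin S))%C = r * cos S by simpc.
split=> [/eqP|->]; last by rewrite mulr0 rmorph0 !mulr0.
rewrite !mulf_eq0 expf_eq0 (negPf y0') andbF pnatr_eq0 /=.
by rewrite fmorph_eq0 mulf_eq0 gt_eqF //= => /eqP.
Qed.

(** * Bounds on the arctangent *)

Lemma ge0_of_derive {R : realType} (f df : R -> R) (x : R) :
  (forall z : R, is_derive z 1 f (df z)) -> (forall z : R, 0 <= z -> 0 <= df z) ->
  f 0 = 0 -> 0 <= x -> 0 <= f x.
Proof.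
move=> fd df0 f0 x0.
have cf : {within `[0, x], continuous f}.
  apply: continuous_subspaceT => z.
  by apply/differentiable_continuous/derivable1_diffP; have [] := fd z.
have [c /itvP cI e] := MVT_segment x0 (fun z _ => fd z) cf.
by have := e; rewrite f0 !subr0 => ->; rewrite mulr_ge0 // df0 // cI.
Qed.

Lemma atan_ge0 {R : realType} (x : R) : 0 <= x -> 0 <= atan x.
Proof.
apply: (@ge0_of_derive _ _ (fun z => (1 + z ^+ 2)^-1)); last exact: atan0.
by move=> z z0; rewrite invr_ge0 addr_ge0 // sqr_ge0.
Qed.

Lemma atan_le {R : realType} (x : R) : 0 <= x -> atan x <= x.
Proof.
move=> x0; rewrite -subr_ge0.
apply: (@ge0_of_derive _ (fun z => z - atan z) (fun z => 1 - (1 + z ^+ 2)^-1)) => //.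
  by move=> z z0; rewrite subr_ge0 invf_le1; have := sqr_ge0 z; lra.
by rewrite atan0 subr0.
Qed.

(** The cubic coefficient 1 in place of the sharp 1/3 is harmless: it only affects the constant in
    the O(1). *)
Lemma atan_ge {R : realType} (x : R) : 0 <= x -> x - x ^+ 3 <= atan x.
Proof.
move=> x0; rewrite -subr_ge0.
apply: (@ge0_of_derive _ (fun z => atan z - (z - z ^+ 3))
          (fun z => (1 + z ^+ 2)^-1 - (1 - (3 * z ^+ 2)))) => //.
- move=> z; apply: is_derive_eq.
  by rewrite /GRing.scale /=; ring.
- move=> z z0; have z2 := sqr_ge0 z.
  have -> : (1 + z ^+ 2)^-1 - (1 - 3 * z ^+ 2) =
      (2 * z ^+ 2 + 3 * (z ^+ 2) ^+ 2) / (1 + z ^+ 2).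
    by field; rewrite gt_eqF //; lra.
  by rewrite divr_ge0 //; nra.
- by rewrite atan0 expr0n /=; ring.
Qed.

(** * The angle sum and the zeros of its cosine *)

Definition half_odd (R : realType) (i : nat) : R := i%:R + 2^-1.

Definition angle_sum {R : realType} (d : nat) (w : R) : R :=
  \sum_(i < d) atan (half_odd R i * w).

Lemma half_odd_gt0 {R : realType} (i : nat) : 0 < half_odd R i.
Proof. by rewrite ltr_wpDl // invr_gt0. Qed.

Lemma sum_half_odd {R : realType} (d : nat) :
  \sum_(i < d) half_odd R i = d%:R ^+ 2 / 2.
Proof.
elim: d => [|d IH]; first by rewrite big_ord0 expr0n mul0r.
by rewrite big_ord_recr /= IH /half_odd -natr1; field.
Qed.

(** The left side is the midpoint rule for the integral of [x^3] over [[0, d]], an underestimate by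
    convexity. *)
Lemma sum_half_odd_cube {R : realType} (d : nat) :
  \sum_(i < d) half_odd R i ^+ 3 <= d%:R ^+ 4 / 4.
Proof.
elim: d => [|d IH]; first by rewrite big_ord0 mulr_ge0.
rewrite big_ord_recr /=; apply: le_trans (lerD IH (lexx _)) _.
rewrite /half_odd -[d.+1%:R]natr1 -subr_ge0; set x := d%:R : R.
have -> : (x + 1) ^+ 4 / 4 - (x ^+ 4 / 4 + (x + 2^-1) ^+ 3) = x / 4 + 8^-1 by field.
by rewrite addr_ge0 // divr_ge0 // ler0n.
Qed.

Lemma angle_sumN {R : realType} (d : nat) (w : R) :
  angle_sum d (- w) = - angle_sum d w.
Proof.
by rewrite /angle_sum -sumrN; apply: eq_bigr => i _; rewrite mulrN atanN.
Qed.

Lemma angle_sum_ge0 {R : realType} (d : nat) (w : R) :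
  0 <= w -> 0 <= angle_sum d w.
Proof.
move=> w0; apply: sumr_ge0 => i _.
by rewrite atan_ge0 // mulr_ge0 // ltW // half_odd_gt0.
Qed.

Lemma angle_sum_le {R : realType} (d : nat) (w : R) :
  0 <= w -> angle_sum d w <= w * (d%:R ^+ 2 / 2).
Proof.
move=> w0; rewrite -sum_half_odd mulr_sumr; apply: ler_sum => i _.
by rewrite [w * _]mulrC atan_le // mulr_ge0 // ltW // half_odd_gt0.
Qed.

Lemma angle_sum_ge {R : realType} (d : nat) (w : R) :
  0 <= w -> w * (d%:R ^+ 2 / 2) - w ^+ 3 * (d%:R ^+ 4 / 4) <= angle_sum d w.
Proof.
move=> w0.
apply: (@le_trans _ _ (\sum_(i < d) (half_odd R i * w - (half_odd R i * w) ^+ 3))).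
  rewrite sumrB -mulr_suml sum_half_odd mulrC lerD2l lerN2.
  under eq_bigr do rewrite exprMn.
  rewrite -mulr_suml mulrC; apply: ler_wpM2l; first exact: exprn_ge0.
  exact: sum_half_odd_cube.
by apply: ler_sum => i _; rewrite atan_ge // mulr_ge0 // ltW // half_odd_gt0.
Qed.

Lemma continuous_angle_sum {R : realType} (d : nat) :
  continuous (@angle_sum R d).
Proof.
move=> w; rewrite /angle_sum.
elim: d => [|d IH].
  under eq_fun do rewrite big_ord0.
  exact: cst_continuous.
under eq_fun do rewrite big_ord_recr /=.
apply: continuousD; first exact: IH.
apply: (@continuous_comp _ _ _ (fun w => half_odd R d * w) atan).
  exact: mulrl_continuous.
exact: continuous_atan.
Qed.

(** For a nonnegative angle sum, a vanishing cosine forces at least [pi / 2], whereas the sum at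
    [1/|y|] is at most [d^2 / (2|y|)]. *)
Lemma cos_angle_sum_eq0 {R : realType} (d : nat) (y : R) :
  y != 0 -> cos (angle_sum d y^-1) = 0 -> `|y| <= d%:R ^+ 2 / pi.
Proof.
move=> y0 h; have {y0} y0 : 0 < `|y| by rewrite normr_gt0.
have {}h : cos (angle_sum d `|y|^-1) = 0.
  case: (ger0P y) => // _; by rewrite invrN angle_sumN cosN.
have w0 : 0 <= `|y|^-1 by rewrite invr_ge0 ltW.
have hpi : pi / 2 <= angle_sum d `|y|^-1.
  rewrite leNgt; apply/negP => lt.
  suff : 0 < cos (angle_sum d `|y|^-1) by rewrite h ltxx.
  apply: cos_gt0_pihalf; rewrite lt andbT.
  by have := angle_sum_ge0 d w0; have := pi_gt0 R; lra.
have h2 := le_trans hpi (angle_sum_le d w0).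
rewrite ler_pdivlMr ?pi_gt0 //.
have := ler_wpM2l (ltW y0) h2; rewrite mulVKf ?gt_eqF //.
set p := pi in h2 *; set q := `|y| in h2 *; lra.
Qed.

Lemma exists_cos_angle_sum_eq0 {R : realType} (d : nat) : (10 <= d)%N ->
  exists y : R, [/\ 0 < y, d%:R ^+ 2 / pi - 16 <= y & cos (angle_sum d y^-1) = 0].
Proof.
move=> d10; have p0 := pi_gt0 R; have p1 := pi_ge2 R.
have p4 : pi <= 4 :> R by have /andP[_] := @pihalf_02 R; lra.
set D : R := d%:R ^+ 2.
have D100 : 100 <= D.
  have : 10 <= d%:R :> R by rewrite ler_nat.
  by rewrite /D; nra.
have D0 : 0 < D by lra.
(* At [w2] the linear term exceeds [pi / 2] by [8 pi / D], and the cubic loss is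
   [(pi / D) (pi^2 u^3 / 4)]. With [pi <= 4] and [u^3 <= 2] this loss is at most [8 pi / D], whence
   the 16. *)
pose u := 1 + 16 / D.
have u1 : 1 <= u by rewrite lerDl divr_ge0 // ltW.
have u2 : u <= 5 / 4.
  by have : 16 / D <= 1 / 4; [rewrite ler_pdivrMr //; lra|rewrite /u; lra].
have u3 : u ^+ 3 <= 2.
  apply: (@le_trans _ _ ((5 / 4) ^+ 3)); last by lra.
  by apply: lerXn2r; rewrite ?nnegrE //; lra.
pose w1 := pi / D; pose w2 := pi / D * u.
have w10 : 0 < w1 by rewrite divr_gt0.
have w12 : w1 <= w2 by rewrite ler_peMr // ltW.
have S1 : angle_sum d w1 <= pi / 2.
  apply: le_trans (angle_sum_le d (ltW w10)) _.
  by rewrite -/D mulrA divfK ?gt_eqF.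
have S2 : pi / 2 <= angle_sum d w2.
  have := angle_sum_ge d (le_trans (ltW w10) w12).
  have -> : d%:R ^+ 4 = D ^+ 2 :> R by rewrite -exprM.
  rewrite -/D; apply: le_trans; rewrite -subr_ge0.
  have -> : w2 * (D / 2) - w2 ^+ 3 * (D ^+ 2 / 4) - pi / 2 =
      pi / D * (8 - pi ^+ 2 * u ^+ 3 / 4).
    by rewrite /w2 /u; field; rewrite gt_eqF.
  apply: mulr_ge0; first exact: ltW.
  have : pi ^+ 2 * u ^+ 3 <= 16 * 2 :> R.
    by apply: ler_pM; rewrite ?exprn_ge0 //; nra.
  lra.
have [|w] := IVT (v := pi / 2) w12 (continuous_subspaceT (@continuous_angle_sum R d)).
  by rewrite ge_min S1 le_max S2 orbT.
rewrite in_itv /= => /andP[ww1 ww2] Sw.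
have w0 : 0 < w := lt_le_trans w10 ww1.
exists w^-1; split; rewrite ?invr_gt0 // ?invrK ?Sw ?cos_pihalf //.
apply: (@le_trans _ _ w2^-1); last by rewrite lef_pV2 // posrE // (lt_le_trans w10).
have -> : w2^-1 = D / pi * u^-1.
  by rewrite /w2 invfM invf_div.
(* From [(1 - t) (1 + t) <= 1]. Multiplied by [D / pi], the error [16 / D] becomes the bounded
   [16 / pi]. *)
have iu : 1 - 16 / D <= u^-1.
  rewrite -[X in _ <= X]mul1r ler_pdivlMr; last by lra.
  by rewrite /u; set t := 16 / D; have := sqr_ge0 t; nra.
have := ler_wpM2l (ltW (divr_gt0 D0 p0)) iu.
apply: le_trans.
have -> : D / pi * (1 - 16 / D) = D / pi - 16 / pi.
  by rewrite mulrBr mulr1 [_ * (16 / D)]mulrC mulrA divfK // gt_eqF.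
rewrite lerD2l lerN2 ler_pdivrMr //; lra.
Qed.

(** [complex.Re] only turns the norm, a real value inside [R[i]], into an element of [R]. *)
Theorem max_norm_root_asymptotics {R : realType} (beta : nat -> R[i]) :
  (forall d : nat, (0 < d)%N -> max_norm_root (M_poly R d) (beta d)) ->
  (fun d : nat => complex.Re `|beta d + 2^-1|) =
    (fun d : nat => d%:R ^+ 2 / pi) +O_\oo (fun=> 1 : R).
Proof.
move=> hb; apply/eqaddOP; near=> k; near=> d.
have k16 : 16 < k by near: k; exact: nbhs_pinfty_gt.
have d10 : (10 <= d)%N by near: d; exact: nbhs_infty_ge.
have d0 : (0 < d)%N by exact: leq_trans d10.
rewrite normr1 mulr1; apply: le_trans (ltW k16).
have halfE : 2^-1 = (2^-1)%:C%C :> R[i] by rewrite fmorphV /= rmorph_nat.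
have rootE (z : R[i]) : complex_root (M_poly R d) z <->
    \prod_(i < d) (z + 2^-1 + (half_odd R i)%:C%C) +
    \prod_(i < d) (z + 2^-1 - (half_odd R i)%:C%C) = 0.
  rewrite M_poly_rootE; suff e i : (half_odd R i)%:C%C = i%:R + 2^-1.
    by under eq_bigr do rewrite -e; under [X in _ + X]eq_bigr do rewrite -e.
  by rewrite /half_odd rmorphD /= rmorph_nat halfE.
have [rt mx] := hb d d0.
have rt' := (rootE _).1 rt.
have re0 := Re_prod_sym_eq0 d0 half_odd_gt0 rt'.
have [y [y0 ylo cy]] := @exists_cos_angle_sum_eq0 R d d10.
set b := complex.Im (beta d + 2^-1).
have bE : beta d + 2^-1 = (0 +i* b)%C.
  by rewrite [LHS]complexE re0 rmorph0 add0r; simpc.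
have nb : complex.Re `|beta d + 2^-1| = `|b|.
  by rewrite bE normc_def /= expr0n add0r sqrtr_sqr.
have yrt : complex_root (M_poly R d) ((0 +i* y)%C - 2^-1).
  by apply/rootE; rewrite subrK; apply/imaginary_rootE => //; rewrite gt_eqF.
(* Both roots have real part -1/2, so comparing their norms compares their imaginary parts. *)
have yb : y <= `|b|.
  have := mx _ yrt; rewrite -[beta d](addrK 2^-1) bE !normc_def lecR halfE; simpc => /=.
  rewrite ler_sqrt; last by rewrite addr_ge0 ?sqr_ge0.
  by rewrite lerD2l -[b ^+ 2]real_normK ?num_real // ler_pXn2r ?nnegrE // ltW.
have b0 : b != 0 by rewrite -normr_gt0 (lt_le_trans y0).
have bhi : `|b| <= d%:R ^+ 2 / pi.
  apply: cos_angle_sum_eq0 => //.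
  by apply/(@imaginary_rootE R d (half_odd R) b b0); rewrite -bE.
rewrite -[(_ - _) d]/(complex.Re `|beta d + 2^-1| - d%:R ^+ 2 / pi) nb.
rewrite ler_norml; apply/andP; split; lra.
Unshelve. all: by end_near.
Qed.

(** * Convex hulls of finite families *)

(** With total weight [t] the coefficients are barycentric coordinates scaled to the [t]-th dilate,
    where integrality becomes meaningful. *)
Definition nonneg_comb {R : realType} (I : finType) n (w : I -> 'rV[R]_n) (t : R) :
    set 'rV[R]_n :=
  [set \sum_i a i *: w i | a in [set a : I -> R | (forall i, 0 <= a i) /\ \sum_i a i = t]].

Lemma convex_setE {R : realType} n (C : set 'rV[R]_n) :
  convex_set C <->
  (forall x y (s : R), C x -> C y -> 0 <= s <= 1 -> C (s *: x + (1 - s) *: y)).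
Proof.
split=> [cC x y s Cx Cy /andP[s0 s1]|cC x y k].
  have := cC x y (Itv01 s0 s1); rewrite !inE; exact.
rewrite !inE => Cx Cy; apply: cC => //.
by apply/andP; split; [exact: ge0|exact: le1].
Qed.

Lemma nonneg_comb_convex {R : realType} (I : finType) n (w : I -> 'rV[R]_n) :
  convex_set (nonneg_comb w 1).
Proof.
apply/convex_setE => _ _ s [a [a0 a1] <-] [b [b0 b1] <-] /andP[s0 s1].
exists (fun i => s * a i + (1 - s) * b i); first split.
- by move=> i; rewrite addr_ge0 // mulr_ge0 // subr_ge0.
- by rewrite big_split -!mulr_sumr a1 b1 /=; ring.
rewrite !scaler_sumr -big_split /=; apply: eq_bigr => i _.
by rewrite !scalerA -scalerDl.
Qed.

Lemma nonneg_comb_gen {R : realType} (I : finType) n (w : I -> 'rV[R]_n) (i : I) :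
  nonneg_comb w 1 (w i).
Proof.
exists (fun j => (j == i)%:R); first split.
- by move=> j; exact: ler0n.
- by rewrite (bigD1 i) //= eqxx big1 ?addr0 // => j /negPf ->.
- rewrite (bigD1 i) //= eqxx scale1r big1 ?addr0 // => j /negPf ->.
  by rewrite scale0r.
Qed.

Lemma nonneg_comb_sub_convex {R : realType} (I : finType) n (w : I -> 'rV[R]_n)
    (C : set 'rV[R]_n) :
  convex_set C -> (forall i, C (w i)) -> nonneg_comb w 1 `<=` C.
Proof.
move=> /convex_setE cC Cw _ [a [a0 a1] <-].
(* Induction on a sequence: split off the first weight and rescale the others by [1 / (1 - b i)],
   or, if [b i = 1], note that they vanish. *)
suff H (r : seq I) (b : I -> R) : (forall i, 0 <= b i) -> \sum_(i <- r) b i = 1 ->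
    C (\sum_(i <- r) b i *: w i) by exact: H.
elim: r b => [|i r IH] b b0; first by rewrite big_nil => /eqP; rewrite eq_sym oner_eq0.
rewrite !big_cons => b1.
have r0 : 0 <= \sum_(j <- r) b j by apply: sumr_ge0.
have [bi1|bi1] := eqVneq (b i) 1.
  have /eqP : \sum_(j <- r) b j = 0 by move: b1; rewrite bi1; lra.
  rewrite psumr_eq0 // => /allP h.
  rewrite bi1 scale1r big_seq big1 ?addr0 // => j jr.
  by have /eqP -> := h j jr; rewrite scale0r.
have q0 : 1 - b i != 0 by rewrite subr_eq0 eq_sym.
rewrite (_ : \sum_(j <- r) b j *: w j =
    (1 - b i) *: \sum_(j <- r) ((1 - b i)^-1 * b j) *: w j); last first.
  by rewrite scaler_sumr; apply: eq_bigr => j _; rewrite scalerA mulVKf.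
have bi : b i <= 1 by lra.
apply: cC; rewrite ?b0 ?bi //; apply: IH.
  by move=> j; rewrite mulr_ge0 // invr_ge0 subr_ge0.
by rewrite -mulr_sumr (_ : \sum_(j <- r) b j = 1 - b i) ?mulVf //; lra.
Qed.

Lemma dilate_nonneg_comb {R : realType} (I : finType) n (w : I -> 'rV[R]_n) (t : nat) :
  (0 < t)%N -> dilate t (nonneg_comb w 1) = nonneg_comb w t%:R.
Proof.
move=> t0; have t0' : t%:R != 0 :> R by rewrite pnatr_eq0 -lt0n.
apply/seteqP; split=> x.
  move=> [_ [a [a0 a1] <-] <-]; exists (fun i => t%:R * a i); first split.
  - by move=> i; rewrite mulr_ge0.
  - by rewrite -mulr_sumr a1 mulr1.
  by rewrite scaler_sumr; apply: eq_bigr => i _; rewrite scalerA.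
move=> [a [a0 a1] <-].
exists (\sum_i (t%:R^-1 * a i) *: w i).
  exists (fun i => t%:R^-1 * a i) => //; split.
    by move=> i; rewrite mulr_ge0 // invr_ge0.
  by rewrite -mulr_sumr a1 mulVf.
by rewrite scaler_sumr; apply: eq_bigr => i _; rewrite scalerA mulVKf.
Qed.

Lemma convex_hull_convex {R : realType} n (A : set 'rV[R]_n) :
  convex_set (convex_hull A).
Proof.
apply/convex_setE => x y s hx hy s01 C [/= cC AC].
by apply: ((convex_setE C).1 cC) s01; [exact: hx|exact: hy].
Qed.

Lemma convex_polytope_nonneg_comb {R : realType} n (P : set 'rV[R]_n) :
  convex_polytope P -> exists m (v : 'I_m -> 'rV[R]_n), P = nonneg_comb v 1.
Proof.
move=> [A [/finite_seqP[s As] _] ->].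
exists (size s), (tnth (in_tuple s)); apply/seteqP; split.
  apply: smallest_sub; first exact: nonneg_comb_convex.
  move=> x; rewrite As /= => /(nthP 0)[i si <-].
  have := nonneg_comb_gen (tnth (in_tuple s)) (Ordinal si).
  by rewrite (tnth_nth 0).
apply: nonneg_comb_sub_convex; first exact: convex_hull_convex.
move=> i; apply: sub_gen_smallest; rewrite As /=; exact: mem_tnth.
Qed.

(* A generating family of minimal size consists of vertices: if [v i] were a proper
   convex combination, solving for [v i] would make it redundant. *)
Lemma convex_polytope_vertices {R : realType} n (P : set 'rV[R]_n) :
  convex_polytope P -> exists m (v : 'I_m -> 'rV[R]_n),
    P = nonneg_comb v 1 /\ forall i, vertex P (v i).
Proof.
move=> /convex_polytope_nonneg_comb hP.
have ex : exists m, `[< exists v : 'I_m -> 'rV[R]_n, P = nonneg_comb v 1 >].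
  by have [m [v e]] := hP; exists m; apply/asboolP; exists v.
case: (ex_minnP ex) => m /asboolP[v Pv] mmin.
exists m, v; split => // i; split; first by rewrite Pv; exact: nonneg_comb_gen.
move=> y z s; rewrite Pv => -[a [a0 a1] <-] [b [b0 b1] <-] /andP[s0 s1] vi.
pose c j := s * a j + (1 - s) * b j.
have c0 j : 0 <= c j by rewrite addr_ge0 // mulr_ge0 // ?subr_ge0 ltW.
have c1 : \sum_j c j = 1 by rewrite big_split -!mulr_sumr a1 b1 /=; ring.
have vc : v i = \sum_j c j *: v j.
  rewrite vi !scaler_sumr -big_split /=; apply: eq_bigr => j _.
  by rewrite !scalerA -scalerDl.
have le1 (e : 'I_m -> R) : (forall j, 0 <= e j) -> \sum_j e j = 1 -> e i <= 1.
  move=> e0; rewrite (bigD1 i) //= => <-; rewrite lerDl; exact: sumr_ge0.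
have extreme (e : 'I_m -> R) : (forall j, 0 <= e j) -> \sum_j e j = 1 -> e i = 1 ->
    \sum_j e j *: v j = v i.
  move=> e0 e1 ei; move: e1; rewrite (bigD1 i) //= ei [\sum_j e j *: v j](bigD1 i) //= ei => e1.
  have /eqP : \sum_(j < m | j != i) e j = 0 by lra.
  rewrite psumr_eq0 // => /allP h.
  rewrite scale1r big1 ?addr0 // => j ji.
  by have := h j (mem_index_enum _); rewrite ji => /eqP ->; rewrite scale0r.
(* If the proper mean [c i] of [a i <= 1] and [b i <= 1] is 1, both are 1, so both points equal
   [v i]. *)
have [ci|ci] := eqVneq (c i) 1.
  have ai := le1 a a0 a1; have bi := le1 b b0 b1.
  split; apply: extreme => //; move: ci; rewrite /c; nra.
exfalso; case: m i v mmin Pv a a0 a1 b b0 b1 vi c c0 c1 vc le1 extreme ci => [[]//|m].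
move=> i v mmin Pv a a0 a1 b b0 b1 vi c c0 c1 vc le1 _ ci.
suff : (m.+1 <= m)%N by rewrite ltnn.
apply: mmin; apply/asboolP; exists (v \o lift i).
have q0 : 1 - c i != 0 by rewrite subr_eq0 eq_sym.
have ci1 := le1 c c0 c1.
have vi' : nonneg_comb (v \o lift i) 1 (v i).
  exists (fun k => (1 - c i)^-1 * c (lift i k)); first split.
  - by move=> k; rewrite mulr_ge0 // invr_ge0 subr_ge0.
  - rewrite -mulr_sumr (_ : \sum_k c (lift i k) = 1 - c i) ?mulVf //.
    by rewrite -[1]c1 (bigD1_ord i) //= [RHS]addrC addKr.
  - move: vc; rewrite (bigD1_ord i) //= => /eqP; rewrite addrC -subr_eq => /eqP h.
    under eq_bigr do rewrite -scalerA.
    by rewrite -scaler_sumr -h -{1}[v i]scale1r -scalerBl scalerA mulVf // scale1r.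
rewrite Pv; apply/seteqP; split; apply: nonneg_comb_sub_convex;
  try exact: nonneg_comb_convex.
- move=> j; case: (unliftP i j) => [k ->|->] //.
  exact: (nonneg_comb_gen (v \o lift i)).
- by move=> k; exact: nonneg_comb_gen.
Qed.

(** * Counting lattice points *)

Lemma prod_natrB_ffact {R : comNzRingType} (m d : nat) :
  \prod_(i < d) (m%:R - i%:R) = (m ^_ d)%:R :> R.
Proof.
elim: d => [|d IH]; first by rewrite big_ord0 ffactn0.
rewrite big_ord_recr /= IH ffactnSr natrM.
have [dm|md] := leqP d m; first by rewrite natrB.
(* For [m < d] truncated subtraction is wrong, but [m ^_ d] is already 0. *)
by rewrite ffact_small // !mul0r.
Qed.

Lemma M_poly_nat {R : realType} (d t : nat) :
  (M_poly R d).[t%:R] = ('C(t + d, d) + 'C(t, d))%:R.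
Proof.
have B k : (binomial_poly R k%:Z d).[t%:R] = 'C(t + k, d)%:R.
  have := horner_binomial_poly idfun k d (t%:R : R).
  rewrite map_poly_id // => ->; rewrite -natrD prod_natrB_ffact -bin_ffact natrM.
  by rewrite mulrC mulfK // pnatr_eq0 -lt0n fact_gt0.
by rewrite /M_poly hornerD (B d) (B 0%N) addn0 natrD.
Qed.

Lemma ehrhart_M_poly_enum {R : realType} n (P : set 'rV[R]_n) (d t : nat) :
  ehrhart_polynomial_of P (M_poly R d) ->
  exists g : 'I_('C(t + d, d) + 'C(t, d)) -> 'rV[R]_n, injective g /\
    forall x, (dilate t P x /\ lattice_point x) <-> exists i, g i = x.
Proof.
move=> /(_ t)[k kP /eqP]; rewrite M_poly_nat eqr_nat => /eqP ->.
move: kP; rewrite card_eq_sym => /card_set_bijP[g [gf gi gs]].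
exists g; split=> [i j e|x].
  by apply: val_inj; apply: gi e; rewrite inE /=.
split=> [/gs[i ik <-]|[i <-]]; first by exists (Ordinal ik).
by apply: gf => /=.
Qed.

(** Every column of [D] is a combination of [\rank D] independent ones, so the matching coordinates
    determine a vector of the row space. *)
Lemma colsub_inj_rank {R : fieldType} m n (D : 'M[R]_(m, n)) :
  exists f : 'I_(\rank D) -> 'I_n,
    forall u : 'rV_n, (u <= D)%MS -> colsub f u = 0 -> u = 0.
Proof.
rewrite -mxrank_tr; exists (maxrankfun D^T) => u /submxP[a ->].
have /submxP[B DB] : (D^T <= rowsub (maxrankfun D^T) D^T)%MS by rewrite eq_maxrowsub.
have {}DB : D = colsub (maxrankfun D^T) D *m B^T.
  rewrite -[LHS]trmxK [X in X^T = _]DB trmx_mul; congr (_ *m _).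
  by apply/matrixP => i j; rewrite !mxE.
by rewrite -mulmx_colsub => h; rewrite {1}DB mulmxA h mul0mx.
Qed.

(** By [colsub_inj_rank] a point is determined by [\rank D] of its coordinates, each an integer in
    [[-N, N]]; adding [N] encodes it as an ordinal. *)
Lemma lattice_count_bound {R : realType} m n (D : 'M[R]_(m, n)) (x0 : 'rV_n)
    (N k : nat) (g : 'I_k -> 'rV_n) :
  injective g -> (forall i, lattice_point (g i)) ->
  (forall i, (g i - x0 <= D)%MS) -> (forall i j, `|g i ord0 j| <= N%:R) ->
  (k <= (2 * N).+1 ^ \rank D)%N.
Proof.
move=> ginj glat gD gN; have [f finj] := colsub_inj_rank D.
have H i : exists o : {ffun 'I_(\rank D) -> 'I_(2 * N).+1},
    forall j, g i ord0 (f j) = (o j)%:R - N%:R.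
  suff exo : forall j, exists o : 'I_(2 * N).+1, g i ord0 (f j) = o%:R - N%:R.
    by have [q hq] := choice exo; exists [ffun j => q j] => j; rewrite ffunE.
  move=> j; have /intrP[z zE] := glat i (f j).
  have := gN i (f j); rewrite zE ler_norml [N%:R]pmulrn => /andP[].
  rewrite -mulrNz !ler_int => lo hi.
  have zb : (absz (z + N%:Z)%R < (2 * N).+1)%N by lia.
  exists (Ordinal zb) => /=.
  have -> : (absz (z + N%:Z)%R)%:R = (z + N%:Z)%:~R :> R.
    by rewrite [LHS]pmulrn; congr _%:~R; lia.
  by rewrite intrD mulrNz addrK.
have [h hh] := choice H.
have hinj : injective h.
  move=> i i' e; apply: ginj; apply/eqP; rewrite -subr_eq0; apply/eqP/finj.
    rewrite (_ : g i - g i' = (g i - x0) - (g i' - x0)); last first.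
      by rewrite opprB addrA subrK.
    by rewrite addmx_sub // eqmx_opp.
  by apply/rowP => j; rewrite !mxE !hh e subrr.
by have := leq_card h hinj; rewrite card_ffun !card_ord.
Qed.

Lemma polynomial_growth_contra (d e K : nat) (k : nat -> nat) : (e < d)%N ->
  (* The lower bound grows like [t^d / d!], the upper one like [t^e]. *)
  (forall t, (0 < t)%N -> 'C(t + d, d) <= k t)%N ->
  (forall t, (0 < t)%N -> k t <= (2 * (t * K)).+1 ^ e)%N -> False.
Proof.
move=> ed lo hi; pose B := (2 * K).+1; pose t := (d`! * B ^ d.-1).+1.
have h : (t ^ d <= (d`! * B ^ d.-1) * t ^ d.-1)%N.
  apply: (@leq_trans ('C(t + d, d) * d`!)%N).
    rewrite bin_ffact ffact_prod -[X in (t ^ X <= _)%N](card_ord d) -prod_nat_const.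
    by apply: leq_prod => i _; have := ltn_ord i; lia.
  rewrite mulnC -mulnA leq_mul2l; apply/orP; right.
  apply: leq_trans (lo t isT) _; apply: leq_trans (hi t isT) _.
  rewrite -expnMn; apply: (@leq_trans ((B * t) ^ e)%N).
    by case: (e) => // e'; rewrite leq_exp2r // /B; move: (t) (isT : (0 < t)%N) => s s0; nia.
  by apply: leq_pexp2l; [rewrite muln_gt0|case: (d) ed].
move: h; rewrite -[X in (t ^ X <= _)%N](prednK (leq_ltn_trans (leq0n e) ed)) expnS.
by rewrite leq_pmul2r ?expn_gt0 // ltnn.
Qed.

Lemma nonneg_comb_bound {R : realType} (I : finType) n (w : I -> 'rV[R]_n) :
  exists K : nat, forall (t : nat) x j,
    nonneg_comb w t%:R x -> `|x ord0 j| <= (t * K)%:R.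
Proof.
exists (Num.bound (\sum_i \sum_j `|w i ord0 j|)) => t x j [a [a0 at1] <-].
rewrite summxE; apply: le_trans (ler_norm_sum _ _ _) _.
rewrite natrM -at1 mulr_suml; apply: ler_sum => i _.
rewrite mxE normrM ger0_norm //; apply: ler_wpM2l => //.
have s0 k : 0 <= \sum_j `|w k ord0 j| by apply: sumr_ge0.
apply: le_trans (ltW (archi_boundP _)); last by apply: sumr_ge0.
rewrite (bigD1 i) //= (bigD1 j) //= -addrA lerDl addr_ge0 //.
  by apply: sumr_ge0.
by apply: sumr_ge0.
Qed.

(* If the differences [w i - w 0] were dependent, the lattice points of the dilates
   would inject into boxes of dimension less than [d]. *)
Lemma ehrhart_affinely_independent {R : realType} n (d : nat)
    (w : 'I_d.+1 -> 'rV[R]_n) (c : 'I_d.+1 -> R) :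
  ehrhart_polynomial_of (nonneg_comb w 1) (M_poly R d) ->
  \sum_i c i = 0 -> \sum_i c i *: w i = 0 -> forall i, c i = 0.
Proof.
move=> ehr c1 cw.
(* The rows are the edges at [w ord0]; affine independence of [w] is freeness of [D]. *)
pose D : 'M[R]_(d, n) := \matrix_i (w (lift ord0 i) - w ord0).
have combD (b : 'I_d.+1 -> R) :
    \sum_i b i *: w i - (\sum_i b i) *: w ord0 = (\row_k b (lift ord0 k)) *m D.
  rewrite scaler_suml -sumrB big_ord_recl subrr add0r mulmx_sum_row.
  by apply: eq_bigr => k _; rewrite rowK mxE scalerBr.
have [Dfree|Dnfree] := boolP (row_free D).
  have ck k : c (lift ord0 k) = 0.
    have := combD c; rewrite c1 cw scale0r subr0 => /esym h.
    have /(row_free_inj Dfree) : (\row_k c (lift ord0 k)) *m D = 0 *m D by rewrite mul0mx.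
    by move=> /rowP /(_ k); rewrite !mxE.
  move=> i; case: (unliftP ord0 i) => [k ->|->] //.
  by move: c1; rewrite big_ord_recl big1 ?addr0 // => k _; exact: ck.
exfalso; have [K hK] := nonneg_comb_bound w.
have rD : (\rank D < d)%N.
  by rewrite ltn_neqAle rank_leq_row andbT.
apply: (@polynomial_growth_contra d (\rank D) K
          (fun t => 'C(t + d, d) + 'C(t, d))%N rD) => t t0.
  exact: leq_addr.
have [g [ginj gP]] := ehrhart_M_poly_enum t ehr.
have gi i : nonneg_comb w t%:R (g i) /\ lattice_point (g i).
  by rewrite -dilate_nonneg_comb //; apply/gP; exists i.
apply: (@lattice_count_bound _ _ _ D (t%:R *: w ord0) (t * K) _ g) => //.
- by move=> i; have [] := gi i.
- move=> i; have [[a [a0 at1] <-] _] := gi i.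
  by rewrite -at1 combD submxMl.
- by move=> i j; apply: hK; have [] := gi i.
Qed.

(** * Integral barycentric coordinates and the simplex argument *)

Lemma lattice_pointB {R : realType} n (x y : 'rV[R]_n) :
  lattice_point x -> lattice_point y -> lattice_point (x - y).
Proof. by move=> hx hy i; rewrite !mxE rpredB. Qed.

Lemma lattice_point_comb {R : realType} (I : finType) n (w : I -> 'rV[R]_n) (c : I -> R) :
  (forall i, lattice_point (w i)) -> (forall i, c i \is a Num.int) ->
  lattice_point (\sum_i c i *: w i).
Proof.
move=> wl ci j; rewrite summxE rpred_sum // => i _.
by rewrite mxE rpredM //; exact: wl.
Qed.

(** Coefficient families are the ways to write [t] as an ordered sum of [d + 1] naturals;
    independence makes distinct families give distinct points. *)
Lemma card_nat_comb {R : realType} n (d t k : nat) (w : 'I_d.+1 -> 'rV[R]_n)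
    (g : 'I_k -> 'rV[R]_n) :
  (forall a b : 'I_d.+1 -> R, \sum_i a i = \sum_i b i ->
     \sum_i a i *: w i = \sum_i b i *: w i -> a =1 b) ->
  injective g ->
  (forall b : 'I_d.+1 -> nat, (\sum_i b i = t)%N ->
     exists i, g i = \sum_j (b j)%:R *: w j) ->
  #|[set i | `[< exists b : 'I_d.+1 -> nat, (\sum_j b j)%N = t /\
       g i = \sum_j (b j)%:R *: w j >]]%SET| = 'C(t + d, d).
Proof.
move=> indep ginj gex; set S := [set i | _]%SET.
pose T := [set s : d.+1.-tuple 'I_t.+1 | (\sum_(i <- s) i == t)%N]%SET.
pose phi (s : d.+1.-tuple 'I_t.+1) := \sum_j (tnth s j : nat)%:R *: w j.
have Tsum s : s \in T -> (\sum_j tnth s j = t)%N.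
  by rewrite inE big_tuple => /eqP.
(* [psi] needs a default value outside [T], so ['I_k] must be inhabited. *)
have k0 : exists i : 'I_k, true.
  have [|i _] := gex (fun j => if j == ord0 then t else 0%N); last by exists i.
  by rewrite big_mkcond_idem //= -big_mkcond big_pred1_eq.
have /choice[psi hpsi] s : exists i : 'I_k, s \in T -> g i = phi s.
  have [sT|_] := boolP (s \in T); last by have [i _] := k0; exists i.
  by have [i gi] := gex _ (Tsum s sT); exists i => _.
have -> : S = psi @: T.
  apply/setP => i; apply/idP/imsetP.
    rewrite inE => /asboolP[b [bt gi]].
    have bj j : (b j < t.+1)%N by rewrite ltnS -bt (bigD1 j) //= leq_addr.
    pose s : d.+1.-tuple 'I_t.+1 := [tuple inord (b j) | j < d.+1].
    have sj j : tnth s j = b j :> nat by rewrite tnth_mktuple inordK.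
    have sT : s \in T.
      by rewrite inE big_tuple; under eq_bigr do rewrite sj; rewrite bt.
    exists s => //; apply: ginj; rewrite gi hpsi //.
    by apply: eq_bigr => j _; rewrite sj.
  move=> [s sT ->]; rewrite inE; apply/asboolP.
  by exists (fun j => tnth s j : nat); split; [exact: Tsum|exact: hpsi].
rewrite card_in_imset; first by rewrite card_ord_partitions addnC.
move=> s s' sT sT' e; apply: eq_from_tnth => j; apply: val_inj.
have := indep (fun j => (tnth s j : nat)%:R) (fun j => (tnth s' j : nat)%:R).
rewrite -!natr_sum !Tsum // => /(_ erefl) h.
have {}h := h (etrans (esym (hpsi s sT)) (etrans (congr1 g e) (hpsi s' sT'))) j.
by apply/eqP; rewrite -(eqr_nat R); apply/eqP; exact: h.
Qed.

Theorem M_poly_not_ehrhart {R : realType} (d : nat) :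
  (2 <= d)%N -> ~ is_ehrhart_polynomial (M_poly R d).
Proof.
move=> d2 [n [P [[/convex_polytope_vertices[m [v [Pv vvert]]] vlat] ehr]]].
have [w [wlat Pw]] : exists w : 'I_d.+1 -> 'rV[R]_n,
    (forall i, lattice_point (w i)) /\ P = nonneg_comb w 1.
  have [] := ehrhart_M_poly_enum 1 ehr.
  (* Here [d >= 2] gives ['C(1, d) = 0], so exactly [d + 1] points remain. *)
  rewrite add1n binSn bin_small // addn0 => w [_ wP].
  have dil1 : dilate 1 P = P by rewrite Pv dilate_nonneg_comb.
  rewrite dil1 in wP.
  have wi i : P (w i) /\ lattice_point (w i) by apply/wP; exists i.
  exists w; split; first by move=> i; have [] := wi i.
  apply/seteqP; split.
    rewrite Pv; apply: nonneg_comb_sub_convex; first exact: nonneg_comb_convex.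
    move=> i; have [k <-] : exists k, w k = v i.
      by apply/wP; split; [case: (vvert i)|exact: vlat].
    exact: nonneg_comb_gen.
  apply: nonneg_comb_sub_convex; last by move=> i; have [] := wi i.
  by rewrite Pv; exact: nonneg_comb_convex.
rewrite Pw in ehr.
have indep (a b : 'I_d.+1 -> R) : \sum_i a i = \sum_i b i ->
    \sum_i a i *: w i = \sum_i b i *: w i -> a =1 b.
  move=> ab abw i; apply/eqP; rewrite -subr_eq0; apply/eqP.
  apply: (ehrhart_affinely_independent (c := fun i => a i - b i) ehr).
    by rewrite sumrB ab subrr.
  by under eq_bigr do rewrite scalerBl; rewrite sumrB abw subrr.
have enum t : (0 < t)%N -> exists g : 'I_('C(t + d, d) + 'C(t, d)) -> 'rV[R]_n,
    [/\ injective g, forall i, nonneg_comb w t%:R (g i) /\ lattice_point (g i),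
        forall x, nonneg_comb w t%:R x -> lattice_point x -> exists i, g i = x &
        #|[set i | `[< exists b : 'I_d.+1 -> nat, (\sum_j b j)%N = t /\
           g i = \sum_j (b j)%:R *: w j >]]%SET| = 'C(t + d, d)].
  move=> t0; have [g [ginj gP]] := ehrhart_M_poly_enum t ehr.
  rewrite dilate_nonneg_comb // in gP.
  exists g; split => //.
  - by move=> i; apply/gP; exists i.
  - by move=> x xt xl; apply/gP.
  apply: card_nat_comb => // b bt; apply/gP; split.
    by exists (fun j => (b j)%:R) => //; split => //; rewrite -natr_sum bt.
  by apply: lattice_point_comb => // i; exact: rpred_nat.
(* For [t < d], ['C(t, d) = 0]: the points with natural coordinates exhaust the lattice points, and
   coordinates are unique. *)
have small t (a : 'I_d.+1 -> R) : (0 < t < d)%N -> (forall i, 0 <= a i) ->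
    \sum_i a i = t%:R -> lattice_point (\sum_i a i *: w i) ->
    forall i, a i \is a Num.int.
  move=> /andP[t0 td] a0 at1 al i; have [g [_ _ gex gcard]] := enum t t0.
  have [|k gk] := gex _ _ al; first by exists a.
  move: gcard; set S := [set i | _]%SET => gcard.
  have ST : S == [set: _]%SET.
    by rewrite eqEcard finset.subsetT cardsT gcard card_ord (bin_small td) addn0 /=.
  have : k \in S by rewrite (eqP ST) inE.
  rewrite inE => /asboolP[b [bt]]; rewrite gk => e.
  have -> : a i = (b i)%:R.
    by apply: (indep a (fun j => (b j)%:R)) => //; rewrite at1 -natr_sum bt.
  exact: rpred_nat.
have d0 : (0 < d)%N by exact: leq_trans d2.
have [g [_ gcomb _ gcard]] := enum d d0.
(* The extra point comes from ['C(d, d) = 1]. *)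
have [k kS] : exists k, k \notin
    [set i | `[< exists b : 'I_d.+1 -> nat, (\sum_j b j)%N = d /\
       g i = \sum_j (b j)%:R *: w j >]]%SET.
  apply: contrapT => /forallNP h.
  have : ('C(d + d, d) + 'C(d, d) <= 'C(d + d, d))%N.
    by rewrite -[X in (_ <= X)%N]gcard -[X in (X <= _)%N]card_ord -cardsT subset_leq_card //;
       apply/fintype.subsetP => i _; apply/negPn/negP/h.
  by rewrite binn addn1 ltnn.
have [[a [a0 ad] ga] glat] := gcomb k.
pose f i := a i - (Num.floor (a i))%:~R.
have fint i : f i \is a Num.int = (a i \is a Num.int).
  by rewrite /f rpredBr // intr_int.
have f0 i : 0 <= f i by rewrite subr_ge0 floor_le.
have f1 i : f i < 1.
  by rewrite ltrBlDl; have := floorD1_gt (a i); rewrite intrD.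
have flat : lattice_point (\sum_i f i *: w i).
  under eq_bigr do rewrite scalerBl.
  rewrite sumrB ga; apply: lattice_pointB => //.
  by apply: lattice_point_comb => // i; exact: intr_int.
have nint : exists i, a i \isn't a Num.int.
  apply/not_existsP => h; move: kS; rewrite inE => /asboolP; apply.
  have /choice[b hb] : forall i, exists b : nat, a i = b%:R.
    by move=> i; apply/natrP; rewrite natrEint a0 andbT; apply/negPn/negP; exact: h.
  exists b; split; last by rewrite -ga; apply: eq_bigr => i _; rewrite hb.
  apply/eqP; rewrite -(eqr_nat R) natr_sum -ad; apply/eqP.
  by apply: eq_bigr => i _; rewrite hb.
(* The sum is [d] minus a sum of floors, hence an integer. *)
have [s fs] : exists s : nat, \sum_i f i = s%:R.
  apply/natrP; rewrite natrEint sumr_ge0 // andbT sumrB ad rpredB ?rpred_nat //.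
  by rewrite rpred_sum // => i _; exact: intr_int.
have nfint : ~ forall i, f i \is a Num.int.
  by move=> h; have [i /negP] := nint; apply; rewrite -fint.
have s0 : (0 < s)%N.
  rewrite lt0n; apply/eqP => s0; apply: nfint => i.
  have /eqP := fs; rewrite s0 psumr_eq0 // => /allP /(_ i (mem_index_enum _)) /eqP ->.
  exact: rpred0.
have sd : (s <= d)%N.
  rewrite -ltnS -(ltr_nat R) -fs -[X in _ < X%:R]card_ord -sumr_const.
  apply: ltr_sum => //; apply/hasP; exists ord0 => //; exact: mem_index_enum.
have {}sd : s = d.
  apply/eqP; rewrite eqn_leq sd leqNgt; apply/negP => sltd; apply: nfint.
  by apply: (small s) => //; rewrite s0.
(* The weights [1 - f j] sum to [(d + 1) - d = 1], and [small] applies at 1 because [1 < d]. *)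
apply: nfint => i; rewrite -[f i](subKr 1) rpredBr ?rpred1 //.
apply: (small 1%N (fun j => 1 - f j)) => //.
- by move=> j; rewrite subr_ge0 ltW.
- by rewrite sumrB fs sd sumr_const card_ord -natrB // subSnn.
under eq_bigr do rewrite scalerBl.
rewrite sumrB; apply: lattice_pointB => //.
by apply: lattice_point_comb => // j; exact: rpred1.
Qed.

Theorem theorem2p3 (R : realType) :
  (forall d : nat, (2 <= d)%N -> ~ is_ehrhart_polynomial (M_poly R d)) /\
  (forall beta : nat -> R[i],
     (forall d : nat, (0 < d)%N -> max_norm_root (M_poly R d) (beta d)) ->
     (fun d : nat => complex.Re `|beta d + 2^-1|) =
       (fun d : nat => d%:R ^+ 2 / pi) +O_\oo (fun=> 1 : R)).
Proof.
split; first exact: M_poly_not_ehrhart.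
exact: max_norm_root_asymptotics.
Qed.
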